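(* Let $R$ be a commutative unital integral domain with $\mathrm{char}(R)=p>0$, let $H$ be a Hopf algebra over $R$, and let $\Pi\subset\Gamma_H$ be a finite subgroup of weights. Suppose $h_1,\dots,h_n\in H$ ($n\ge1$) are pseudo-primitive with respect to $\Pi$, with $\Delta(h_i)=g_i\otimes h_i+h_i\otimes g_i'$. Let $\mathbf h=\prod_{i=1}^nh_i$, $\mathbf g=\prod_{i=1}^n g_i$, and $\Phi=\Pi_{ab}:=\Pi/[\Pi,\Pi]$. Let $\Phi_p$ be the $p$-Sylow subgroup of $\Phi$ and $\Phi'$ a (Hall) subgroup of $\Phi$ of order $|\Phi|/|\Phi_p|$. Then $$\Sigma_\Pi(\mathbf h)=|[\Pi,\Pi]|\cdot\Sigma_{\Phi'}(\mathbf g)\cdot\Sigma_{\Phi_p}(\mathbf h).$$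
   Context: A weight of $H$ is an $R$-algebra homomorphism $H\to R$. The set $\Gamma_H$ of weights is a group under convolution $(\lambda*\nu)(h)=(\lambda\otimes\nu)(\Delta(h))$, with identity the counit $\varepsilon$ and inverse $\lambda^{-1}=\lambda\circ S$. $\Sigma_\Pi:=\sum_{\gamma\in\Pi}\gamma:H\to R$. $G(H)$ is the group of grouplike elements ($\Delta(g)=g\otimes g$, $\varepsilon(g)=1$). An element $h\in H$ is pseudo-primitive with respect to $\Pi$ if $\Delta(h)=g\otimes h+h\otimes g'$ for some $g,g'\in G(H)$ with $\gamma(g^{-1}g')=1$ for all $\gamma\in\Pi$. Integers are viewed in $R$ via $\mathbb Z\to R$. For a subgroup $\Theta\subset\Phi=\Pi/[\Pi,\Pi]$ and $x\in\{\mathbf g,\mathbf h\}$, $\Sigma_\Theta(x)$ denotes $\sum_{\tilde\gamma\in\widetilde\Theta}\tilde\gamma(x)$, where $\widetilde\Theta\subset\Pi$ is any set containing exactly one lift of each element of $\Theta$; this does not depend on the choice of lifts. *)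

(* Defs.v *)
From HB Require Import structures.
From mathcomp Require Import all_boot all_algebra all_fingroup all_solvable.
From mathcomp Require Import generic_quotient finmap boolp ring.

Set Implicit Arguments.
Unset Strict Implicit.
Unset Printing Implicit Defensive.

Import GRing.Theory.
Local Open Scope ring_scope.
Local Open Scope quotient_scope.

Section TensorModule.
Variables (R : comNzRingType) (M N : lmodType R).

(* A sequence [:: (x1, y1); ...; (xk, yk)] stands for the formal sum of the
   pure tensors xi (x) yi; tens_eq is the congruence for concatenation
   generated by commutativity and R-balanced bilinearity. *)
Inductive tens_eq : seq (M * N) -> seq (M * N) -> Prop :=
| TensRefl s : tens_eq s s
| TensSym s t : tens_eq s t -> tens_eq t s
| TensTrans s t u : tens_eq s t -> tens_eq t u -> tens_eq s u
| TensCat s s' t t' : tens_eq s s' -> tens_eq t t' ->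
    tens_eq (s ++ t) (s' ++ t')
| TensC s t : tens_eq (s ++ t) (t ++ s)
| Tens0 y : tens_eq [:: (0, y)] [::]
| TensDl x x' y : tens_eq [:: (x + x', y)] [:: (x, y); (x', y)]
| TensDr x y y' : tens_eq [:: (x, y + y')] [:: (x, y); (x, y')]
| TensZ a x y : tens_eq [:: (a *: x, y)] [:: (x, a *: y)].

Definition tens_rel : rel (seq (M * N)) := fun s t => `[< tens_eq s t >].

Fact tens_rel_refl : reflexive tens_rel.
Proof. by move=> s; apply/asboolP; apply: TensRefl. Qed.
Fact tens_rel_sym : symmetric tens_rel.
Proof. by move=> s t; apply/asboolP/asboolP; apply: TensSym. Qed.
Fact tens_rel_trans : transitive tens_rel.
Proof. by move=> s t u /asboolP h /asboolP k; apply/asboolP; apply: TensTrans k. Qed.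

Canonical tens_equiv := EquivRel tens_rel tens_rel_refl tens_rel_sym tens_rel_trans.

Definition tensor := {eq_quot tens_equiv}.
HB.instance Definition _ := Choice.on tensor.
HB.instance Definition _ := EqQuotient.on tensor.

Definition tens_of (s : seq (M * N)) : tensor := \pi_tensor s.

Lemma tens_ofP s t : tens_of s = tens_of t <-> tens_eq s t.
Proof.
by split=> [/eqmodP/asboolP//|st]; apply/eqmodP/asboolP.
Qed.

Lemma tens_ofK (t : tensor) : tens_of (repr t) = t.
Proof. exact: reprK. Qed.

Lemma repr_tens_of s : tens_eq (repr (tens_of s)) s.
Proof. by apply/tens_ofP; rewrite tens_ofK. Qed.

Lemma tensW (P : tensor -> Prop) : (forall s, P (tens_of s)) -> forall t, P t.
Proof. by move=> PP t; rewrite -(tens_ofK t). Qed.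

Definition tens_add (t u : tensor) := tens_of (repr t ++ repr u).
Definition tens_scale (a : R) (t : tensor) :=
  tens_of [seq (a *: xy.1, xy.2) | xy <- repr t].
Definition tens_zero : tensor := tens_of [::].

Lemma tens_addE s t : tens_add (tens_of s) (tens_of t) = tens_of (s ++ t).
Proof. by apply/tens_ofP/TensCat; apply: repr_tens_of. Qed.

Lemma tens_eq_scale a s t : tens_eq s t ->
  tens_eq [seq (a *: xy.1, xy.2) | xy <- s] [seq (a *: xy.1, xy.2) | xy <- t].
Proof.
elim=> {s t} [s|s t _|s t u _ st _|s s' t t' _ ss' _|s t|y|x x' y|x y y'|b x y] /=.
- exact: TensRefl.
- exact: TensSym.
- exact: TensTrans.
- by rewrite !map_cat; apply: TensCat.
- by rewrite !map_cat; apply: TensC.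
- by rewrite scaler0; apply: Tens0.
- by rewrite scalerDr; apply: TensDl.
- exact: TensDr.
- by rewrite scalerA mulrC -scalerA; apply: TensZ.
Qed.

Lemma tens_scaleE a s :
  tens_scale a (tens_of s) = tens_of [seq (a *: xy.1, xy.2) | xy <- s].
Proof. by apply/tens_ofP/tens_eq_scale; apply: repr_tens_of. Qed.

Fact tens_addA : associative tens_add.
Proof.
by elim/tensW=> s; elim/tensW=> t; elim/tensW=> u; rewrite !tens_addE catA.
Qed.
Fact tens_addC : commutative tens_add.
Proof.
by elim/tensW=> s; elim/tensW=> t; rewrite !tens_addE; apply/tens_ofP/TensC.
Qed.
Fact tens_add0 : left_id tens_zero tens_add.
Proof. by elim/tensW=> s; rewrite !tens_addE. Qed.

Lemma tens_scaleDr' a t u :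
  tens_scale a (tens_add t u) = tens_add (tens_scale a t) (tens_scale a u).
Proof.
elim/tensW: t => s; elim/tensW: u => t.
by rewrite tens_addE !tens_scaleE tens_addE map_cat.
Qed.

Lemma tens_scaleDl' a b t :
  tens_scale (a + b) t = tens_add (tens_scale a t) (tens_scale b t).
Proof.
elim/tensW: t; elim=> [|[x y] s IHs].
  by rewrite !tens_scaleE /= tens_addE.
have -> : tens_of ((x, y) :: s) = tens_add (tens_of [:: (x, y)]) (tens_of s).
  by rewrite tens_addE.
rewrite !tens_scaleDr' IHs.
suff -> : tens_scale (a + b) (tens_of [:: (x, y)]) =
    tens_add (tens_scale a (tens_of [:: (x, y)])) (tens_scale b (tens_of [:: (x, y)])).
  rewrite -!tens_addA; congr tens_add; rewrite !tens_addA; congr tens_add.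
  by rewrite tens_addC.
rewrite !tens_scaleE tens_addE /=; apply/tens_ofP.
by rewrite scalerDl; apply: TensDl.
Qed.

Lemma tens_scale0 t : tens_scale 0 t = tens_zero.
Proof.
elim/tensW: t; elim=> [|[x y] s IHs]; first by rewrite tens_scaleE.
have -> : tens_of ((x, y) :: s) = tens_add (tens_of [:: (x, y)]) (tens_of s).
  by rewrite tens_addE.
rewrite tens_scaleDr' IHs tens_addC tens_add0 tens_scaleE /= scale0r.
exact/tens_ofP/Tens0.
Qed.

Lemma tens_scale1 : left_id 1 tens_scale.
Proof.
elim/tensW=> s; rewrite tens_scaleE; congr tens_of.
by rewrite -[RHS]map_id; apply: eq_map => -[x y] /=; rewrite scale1r.
Qed.

Fact tens_addN : left_inverse tens_zero (tens_scale (-1)) tens_add.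
Proof.
by move=> t; rewrite -{2}(tens_scale1 t) -tens_scaleDl' addNr tens_scale0.
Qed.

HB.instance Definition _ :=
  GRing.isZmodule.Build tensor tens_addA tens_addC tens_add0 tens_addN.

Fact tens_scaleA a b t : tens_scale a (tens_scale b t) = tens_scale (a * b) t.
Proof.
elim/tensW: t => s; rewrite !tens_scaleE -map_comp; congr tens_of.
by apply: eq_map => -[x y] /=; rewrite scalerA.
Qed.

Fact tens_scaleDr : right_distributive tens_scale +%R.
Proof. exact: tens_scaleDr'. Qed.
Fact tens_scaleDl t : {morph tens_scale^~ t : a b / a + b}.
Proof. by move=> a b; apply: tens_scaleDl'. Qed.

HB.instance Definition _ := GRing.Zmodule_isLmodule.Build R tensor
  tens_scaleA tens_scale1 tens_scaleDr tens_scaleDl.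

Lemma tens_ofD s t : tens_of s + tens_of t = tens_of (s ++ t).
Proof. exact: tens_addE. Qed.

Definition tens (x : M) (y : N) : tensor := tens_of [:: (x, y)].

Lemma tens_of_sum s : tens_of s = \sum_(xy <- s) tens xy.1 xy.2.
Proof.
elim: s => [|[x y] s IHs]; first by rewrite big_nil.
by rewrite big_cons -IHs tens_ofD.
Qed.

Lemma tensDl x x' y : tens (x + x') y = tens x y + tens x' y.
Proof.
rewrite tens_ofD; exact/tens_ofP/TensDl.
Qed.
Lemma tensDr x y y' : tens x (y + y') = tens x y + tens x y'.
Proof.
rewrite tens_ofD; exact/tens_ofP/TensDr.
Qed.
Lemma tensZl a x y : tens (a *: x) y = a *: tens x y.
Proof. by symmetry; apply: tens_scaleE. Qed.
Lemma tensZr a x y : tens x (a *: y) = a *: tens x y.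
Proof. by rewrite -tensZl; symmetry; apply/tens_ofP/TensZ. Qed.

Lemma tens_ind (P : tensor -> Prop) :
    P 0 -> (forall x y, P (tens x y)) -> (forall t u, P t -> P u -> P (t + u)) ->
  forall t, P t.
Proof.
move=> P0 P1 PD; elim/tensW=> s; rewrite tens_of_sum.
by elim/big_ind: _ => // -[x y] _; apply: P1.
Qed.

End TensorModule.

Arguments tensor {R} (M N)%_type_scope.
Notation "M ⊗ N" := (tensor M N) (at level 40, left associativity) : type_scope.
Notation "x ⊗ y" := (tens x y) (at level 40, left associativity) : ring_scope.

Definition bilinear_map (R : comNzRingType) (M N P : lmodType R) (f : M -> N -> P) :=
  (forall y, linear (f^~ y)) /\ (forall x, linear (f x)).

(* The linear map M (x) N -> P induced by a bilinear f; meaningful only when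
   f is bilinear (see tens_lift_linear and tens_liftE). *)
Definition tens_lift (R : comNzRingType) (M N P : lmodType R) (f : M -> N -> P)
    (t : M ⊗ N) : P :=
  \sum_(xy <- repr t) f xy.1 xy.2.

Section TensorLift.
Variables (R : comNzRingType) (M N P : lmodType R) (f : M -> N -> P).
Hypothesis f_bil : bilinear_map f.

Let fDl x x' y : f (x + x') y = f x y + f x' y.
Proof. by have := f_bil.1 y 1 x x'; rewrite !scale1r. Qed.
Let fDr x y y' : f x (y + y') = f x y + f x y'.
Proof. by have := f_bil.2 x 1 y y'; rewrite !scale1r. Qed.
Let f0l y : f 0 y = 0.
Proof. by apply: (addrI (f 0 y)); rewrite -fDl !addr0. Qed.
Let f0r x : f x 0 = 0.
Proof. by apply: (addrI (f x 0)); rewrite -fDr !addr0. Qed.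
Let fZl a x y : f (a *: x) y = a *: f x y.
Proof. by have := f_bil.1 y a x 0; rewrite !addr0 f0l addr0. Qed.
Let fZr a x y : f x (a *: y) = a *: f x y.
Proof. by have := f_bil.2 x a y 0; rewrite !addr0 f0r addr0. Qed.

Lemma tens_lift_of s : tens_lift f (tens_of s) = \sum_(xy <- s) f xy.1 xy.2.
Proof.
rewrite /tens_lift; move: (repr_tens_of s); move: (repr _) => t.
elim=> {s t} //=.
- by move=> s t u _ -> _ ->.
- by move=> s s' t t' _ ss' _ tt'; rewrite !big_cat ss' tt'.
- by move=> s t; rewrite !big_cat /= addrC.
- by move=> y; rewrite big_nil big_seq1 f0l.
- by move=> x x' y; rewrite !big_cons !big_nil /= fDl !addr0.
- by move=> x y y'; rewrite !big_cons !big_nil /= fDr !addr0.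
- by move=> a x y; rewrite !big_seq1 /= fZl fZr.
Qed.

Lemma tens_liftE x y : tens_lift f (x ⊗ y) = f x y.
Proof. by rewrite tens_lift_of big_seq1. Qed.

Lemma tens_liftD t u : tens_lift f (t + u) = tens_lift f t + tens_lift f u.
Proof.
elim/tensW: t => s; elim/tensW: u => t.
by rewrite tens_ofD !tens_lift_of big_cat.
Qed.

Lemma tens_lift0 : tens_lift f 0 = 0.
Proof. by apply: (addrI (tens_lift f 0)); rewrite -tens_liftD !addr0. Qed.

Lemma tens_liftZ a t : tens_lift f (a *: t) = a *: tens_lift f t.
Proof.
elim/tens_ind: t => [|x y|t u IHt IHu].
- by rewrite scaler0 tens_lift0 scaler0.
- by rewrite -tensZl !tens_liftE fZl.
- by rewrite scalerDr !tens_liftD IHt IHu scalerDr.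
Qed.

Lemma tens_lift_linear : linear (tens_lift f).
Proof. by move=> a t u; rewrite tens_liftD tens_liftZ. Qed.

End TensorLift.

Lemma tens_lift_ext (R : comNzRingType) (M N P : lmodType R) (f g : M -> N -> P) t :
  (forall x y, f x y = g x y) -> tens_lift f t = tens_lift g t.
Proof. by move=> fg; apply: eq_bigr => xy _. Qed.

(* f (x) g and the associator, for linear f and g. *)
Definition tens_map (R : comNzRingType) (M N M' N' : lmodType R)
    (f : M -> M') (g : N -> N') : M ⊗ N -> M' ⊗ N' :=
  tens_lift (fun x y => f x ⊗ g y).

Definition tens_assoc (R : comNzRingType) (M N P : lmodType R) :
    (M ⊗ N) ⊗ P -> M ⊗ (N ⊗ P) :=
  tens_lift (fun t z => tens_lift (fun x y => x ⊗ (y ⊗ z)) t).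

Section TensorAlgebra.
Variables (R : comNzRingType) (A B : algType R).

Definition tens_mul (t u : A ⊗ B) : A ⊗ B :=
  tens_lift (fun a b => tens_lift (fun c d => (a * c) ⊗ (b * d)) u) t.

Let mul_bil a b : bilinear_map (fun (c : A) (d : B) => (a * c) ⊗ (b * d) : A ⊗ B).
Proof.
split=> x k y z /=; rewrite mulrDr -scalerAr.
  by rewrite tensDl tensZl.
by rewrite tensDr tensZr.
Qed.

Let mul_bil2 (u : A ⊗ B) :
  bilinear_map (fun a b => tens_lift (fun c d => (a * c) ⊗ (b * d) : A ⊗ B) u).
Proof.
elim/tens_ind: u => [|c d|u v IHu IHv]; split=> x k y z /=.
- by rewrite !tens_lift0 // scaler0 addr0.
- by rewrite !tens_lift0 // scaler0 addr0.
- by rewrite !tens_liftE // mulrDl -scalerAl tensDl tensZl.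
- by rewrite !tens_liftE // mulrDl -scalerAl tensDr tensZr.
- by rewrite !tens_liftD // (IHu.1 x) (IHv.1 x) scalerDr addrACA.
- by rewrite !tens_liftD // (IHu.2 x) (IHv.2 x) scalerDr addrACA.
Qed.

Lemma tens_mulE a b c d : tens_mul (a ⊗ b) (c ⊗ d) = (a * c) ⊗ (b * d).
Proof. by rewrite /tens_mul !tens_liftE. Qed.

Fact tens_mulDl : left_distributive tens_mul +%R.
Proof. by move=> t u v; rewrite /tens_mul tens_liftD. Qed.

Fact tens_mulDr : right_distributive tens_mul +%R.
Proof.
move=> t u v; elim/tens_ind: t => [|a b|s t IHs IHt].
- by rewrite /tens_mul !tens_lift0 ?addr0.
- by rewrite /tens_mul !(tens_liftE (mul_bil2 _)) tens_liftD.
- by rewrite !tens_mulDl IHs IHt addrACA.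
Qed.

Let mul0t t : tens_mul 0 t = 0. Proof. exact: tens_lift0. Qed.
Let mult0 t : tens_mul t 0 = 0.
Proof. by apply: (addrI (tens_mul t 0)); rewrite -tens_mulDr !addr0. Qed.

Lemma tens_mulZl k t u : tens_mul (k *: t) u = k *: tens_mul t u.
Proof. exact: tens_liftZ. Qed.

Lemma tens_mulZr k t u : tens_mul t (k *: u) = k *: tens_mul t u.
Proof.
elim/tens_ind: t => [|a b|s t IHs IHt]; first by rewrite !mul0t scaler0.
  by rewrite /tens_mul !(tens_liftE (mul_bil2 _)) tens_liftZ.
by rewrite !tens_mulDl IHs IHt scalerDr.
Qed.

Fact tens_mulA : associative tens_mul.
Proof.
move=> t u v; elim/tens_ind: t => [|a b|s t IHs IHt]; first by rewrite !mul0t.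
  elim/tens_ind: u => [|c d|s t IHs IHt]; first by rewrite mult0 !mul0t mult0.
    elim/tens_ind: v => [|e f|s t IHs IHt]; first by rewrite !mult0.
      by rewrite !tens_mulE !mulrA.
    by rewrite !tens_mulDr IHs IHt.
  by rewrite tens_mulDl !tens_mulDr tens_mulDl IHs IHt.
by rewrite !tens_mulDl IHs IHt.
Qed.

Fact tens_mul1l : left_id (1 ⊗ 1) tens_mul.
Proof.
elim/tens_ind=> [|a b|s t IHs IHt]; rewrite ?mult0 ?tens_mulE ?mul1r //.
by rewrite tens_mulDr IHs IHt.
Qed.

Fact tens_mul1r : right_id (1 ⊗ 1) tens_mul.
Proof.
elim/tens_ind=> [|a b|s t IHs IHt]; rewrite ?mul0t ?tens_mulE ?mulr1 //.
by rewrite tens_mulDl IHs IHt.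
Qed.

HB.instance Definition _ := GRing.Zmodule_isPzRing.Build (tensor A B)
  tens_mulA tens_mul1l tens_mul1r tens_mulDl tens_mulDr.

Lemma tensM (a c : A) (b d : B) : (a ⊗ b) * (c ⊗ d) = (a * c) ⊗ (b * d).
Proof. exact: tens_mulE. Qed.

Lemma tens11 : 1 ⊗ 1 = 1 :> A ⊗ B. Proof. by []. Qed.

End TensorAlgebra.

(* The counit axioms are read through R (x) H = H = H (x) R, and in the antipode
   axioms "S (x) id followed by the product" is the linear map induced by the
   bilinear (x, y) |-> S x * y. *)
Record hopfAlg (R : comNzRingType) := HopfAlg {
  hopf_alg :> algType R;
  comul : hopf_alg -> hopf_alg ⊗ hopf_alg;
  counit : hopf_alg -> R;
  antipode : hopf_alg -> hopf_alg;
  comul_linear : linear comul;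
  comul_monoid : monoid_morphism comul;
  counit_linear : linear (counit : hopf_alg -> R^o);
  counit_monoid : monoid_morphism counit;
  antipode_linear : linear antipode;
  coassoc h : tens_assoc (tens_map comul idfun (comul h))
              = tens_map idfun comul (comul h);
  counitl h : tens_lift (fun x y => counit x *: y) (comul h) = h;
  counitr h : tens_lift (fun x y => counit y *: x) (comul h) = h;
  antipodel h : tens_lift (fun x y => antipode x * y) (comul h) = (counit h)%:A;
  antipoder h : tens_lift (fun x y => x * antipode y) (comul h) = (counit h)%:A
}.

Section HopfMorphisms.
Variables (R : comNzRingType) (H : hopfAlg R).

HB.instance Definition _ :=
  GRing.isLinear.Build R H (H ⊗ H)%type _ (@comul R H) (@comul_linear R H).
HB.instance Definition _ :=
  GRing.isMonoidMorphism.Build H (H ⊗ H)%type (@comul R H) (@comul_monoid R H).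
HB.instance Definition _ :=
  GRing.isLinear.Build R H R^o _ (@counit R H) (@counit_linear R H).
HB.instance Definition _ :=
  GRing.isMonoidMorphism.Build H R^o (@counit R H) (@counit_monoid R H).
HB.instance Definition _ :=
  GRing.isLinear.Build R H H _ (@antipode R H) (@antipode_linear R H).

End HopfMorphisms.

Section TensorLiftTheory.
Variable R : comNzRingType.

Lemma lin_tens_lift (M N P Q : lmodType R) (f : M -> N -> P) (g : P -> Q) t :
  linear g -> g (tens_lift f t) = tens_lift (fun x y => g (f x y)) t.
Proof.
move=> g_lin; pose gL : {linear P -> Q} := HB.pack g (GRing.isLinear.Build R P Q _ g g_lin).
exact: (linear_sum gL).
Qed.

Lemma linear_tens_lift (M N P Q : lmodType R) (f : Q -> M -> N -> P) t :
  (forall x y, linear (fun q => f q x y)) -> linear (fun q => tens_lift (f q) t).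
Proof.
move=> f_lin k u v; rewrite /tens_lift scaler_sumr -big_split /=.
by apply: eq_bigr => xy _; rewrite f_lin.
Qed.

Lemma tens_lift_exchange (M N M' N' P : lmodType R)
    (f : M -> N -> M' -> N' -> P) t u :
  tens_lift (fun a b => tens_lift (fun c d => f a b c d) u) t =
  tens_lift (fun c d => tens_lift (fun a b => f a b c d) t) u.
Proof. exact: exchange_big. Qed.

Lemma tens_lift_mul (A B : algType R) (P : lmodType R) (f : A -> B -> P) t u :
  bilinear_map f -> tens_lift f (t * u) =
  tens_lift (fun a b => tens_lift (fun c d => f (a * c) (b * d)) u) t.
Proof.
move=> f_bil; rewrite [t * u]/(tens_mul t u) /tens_mul.
rewrite (lin_tens_lift _ _ (tens_lift_linear f_bil)).
apply: tens_lift_ext => a b; rewrite (lin_tens_lift _ _ (tens_lift_linear f_bil)).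
by apply: tens_lift_ext => c d; rewrite tens_liftE.
Qed.

End TensorLiftTheory.

Section Weights.
Variables (R : comNzRingType) (H : hopfAlg R).

Lemma coassoc_lift (P : lmodType R) (T : H -> H -> H -> P) (h : H) :
    (forall y z, linear (fun x => T x y z)) ->
    (forall x z, linear (fun y => T x y z)) ->
    (forall x y, linear (T x y)) ->
  tens_lift (fun a b => tens_lift (fun b1 b2 => T a b1 b2) (comul b)) (comul h) =
  tens_lift (fun a b => tens_lift (fun a1 a2 => T a1 a2 b) (comul a)) (comul h).
Proof.
move=> T1 T2 T3.
pose L := tens_lift (fun x => tens_lift (T x)) : H ⊗ (H ⊗ H) -> P.
have bT x : bilinear_map (T x) by split.
have bL : bilinear_map (fun x => tens_lift (T x)).
  split=> [u|x]; last exact: tens_lift_linear.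
  by apply: linear_tens_lift => y z; apply: T1.
have linL : linear L by apply: tens_lift_linear.
transitivity (L (tens_map idfun (@comul R H) (comul h))).
  rewrite (lin_tens_lift _ _ linL); apply: tens_lift_ext => a b.
  by rewrite /L tens_liftE.
rewrite -coassoc /tens_map /tens_assoc.
have bA : bilinear_map (fun (t : H ⊗ H) (z : H) =>
    tens_lift (fun x y => x ⊗ (y ⊗ z) : H ⊗ (H ⊗ H)) t).
  split=> [z|t].
    apply: tens_lift_linear; split=> [y|x] k u v.
      by rewrite tensDl tensZl.
    by rewrite tensDl tensZl tensDr tensZr.
  apply: linear_tens_lift => x y k u v.
  by rewrite tensDr tensZr tensDr tensZr.
rewrite (lin_tens_lift _ _ (tens_lift_linear bA)) (lin_tens_lift _ _ linL).
apply: tens_lift_ext => a b.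
rewrite tens_liftE // (lin_tens_lift _ _ linL); apply: tens_lift_ext => x y.
by rewrite /L !tens_liftE.
Qed.

Definition weight := {lrmorphism H -> R^o}.
HB.instance Definition _ := gen_eqMixin weight.
HB.instance Definition _ := gen_choiceMixin weight.

Implicit Types l m n : weight.

Lemma weightP l m : l =1 m -> l = m.
Proof.
case: l => f [[[f0 fD]] [[f1 fM]] [fZ]]; case: m => g [[[g0 gD]] [[g1 gM]] [gZ]].
move=> /= /funext fg; subst g.
rewrite (Prop_irrelevance f0 g0) (Prop_irrelevance fD gD).
rewrite (Prop_irrelevance f1 g1) (Prop_irrelevance fM gM).
by rewrite (Prop_irrelevance fZ gZ).
Qed.

Lemma tens_lift_mull (M N : lmodType R) (k : R^o) (f : M -> N -> R^o) t :
  k * tens_lift f t = tens_lift (fun x y => k * f x y : R^o) t.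
Proof. exact: mulr_sumr. Qed.
Lemma tens_lift_mulr (M N : lmodType R) (k : R^o) (f : M -> N -> R^o) t :
  tens_lift f t * k = tens_lift (fun x y => f x y * k : R^o) t.
Proof. exact: mulr_suml. Qed.

(* (l * m) h = (l (x) m) (comul h), through R (x) R = R. *)
Definition weight_mul_fun l m (h : H) : R^o :=
  tens_lift (fun x y => l x * m y : R^o) (comul h).

Let mul_bil l m : bilinear_map (fun x y => l x * m y : R^o).
Proof.
by split=> z k x y /=; rewrite linearP /= ?mulrDl ?mulrDr /GRing.scale /=; ring.
Qed.

Fact weight_mul_linear l m : linear (weight_mul_fun l m).
Proof. by move=> k x y; rewrite /weight_mul_fun linearP tens_lift_linear. Qed.

Fact weight_mul_monoid l m : monoid_morphism (weight_mul_fun l m).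
Proof.
split=> [|x y]; rewrite /weight_mul_fun.
  by rewrite rmorph1 -tens11 tens_liftE // !rmorph1 mulr1.
rewrite rmorphM tens_lift_mul // tens_lift_mulr; apply: tens_lift_ext => a b.
rewrite tens_lift_mull; apply: tens_lift_ext => c d.
by rewrite !rmorphM mulrACA.
Qed.

HB.instance Definition _ l m :=
  GRing.isLinear.Build R H R^o _ (weight_mul_fun l m) (weight_mul_linear l m).
HB.instance Definition _ l m :=
  GRing.isMonoidMorphism.Build H R^o (weight_mul_fun l m) (weight_mul_monoid l m).

Definition weight_mul l m : weight := weight_mul_fun l m : {lrmorphism H -> R^o}.
Definition weight_one : weight := @counit R H : {lrmorphism H -> R^o}.

Fact weight_mulA : associative weight_mul.
Proof.
move=> l m n; apply: weightP => h /=; rewrite /weight_mul_fun.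
under tens_lift_ext => x y do rewrite tens_lift_mull.
rewrite coassoc_lift; last 3 first.
- by move=> y z k u v /=; rewrite linearP /GRing.scale /=; ring.
- by move=> y z k u v /=; rewrite linearP /GRing.scale /=; ring.
- by move=> y z k u v /=; rewrite linearP /GRing.scale /=; ring.
apply: tens_lift_ext => a b; rewrite tens_lift_mulr.
by apply: tens_lift_ext => c d; rewrite mulrA.
Qed.

Fact weight_mul1l : left_id weight_one weight_mul.
Proof.
move=> l; apply: weightP => h /=; rewrite /weight_mul_fun.
rewrite -[in RHS](counitl h) (lin_tens_lift _ _ (linearP l)).
by apply: tens_lift_ext => x y; rewrite linearZ.
Qed.

Fact weight_mul1r : right_id weight_one weight_mul.
Proof.
move=> l; apply: weightP => h /=; rewrite /weight_mul_fun.
rewrite -[in RHS](counitr h) (lin_tens_lift _ _ (linearP l)).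
by apply: tens_lift_ext => x y; rewrite linearZ mulrC.
Qed.

Definition weight_inv_fun l (h : H) : R^o := l (antipode h).

Lemma weight_invl l h :
  tens_lift (fun x y => weight_inv_fun l x * l y : R^o) (comul h) = counit h.
Proof.
transitivity (l (tens_lift (fun x y => antipode x * y) (comul h))).
  rewrite (lin_tens_lift _ _ (linearP l)); apply: tens_lift_ext => x y.
  by rewrite rmorphM.
by rewrite antipodel linearZ rmorph1; apply: mulr1.
Qed.

Lemma weight_invr l h :
  tens_lift (fun x y => l x * weight_inv_fun l y : R^o) (comul h) = counit h.
Proof.
transitivity (l (tens_lift (fun x y => x * antipode y) (comul h))).
  rewrite (lin_tens_lift _ _ (linearP l)); apply: tens_lift_ext => x y.
  by rewrite rmorphM.
by rewrite antipoder linearZ rmorph1; apply: mulr1.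
Qed.

Fact weight_inv_linear l : linear (weight_inv_fun l).
Proof. by move=> k x y; rewrite /weight_inv_fun !linearP. Qed.

(* l \o antipode is multiplicative: (x, y) |-> l (S (x * y)) and
   (x, y) |-> l (S x) * l (S y) are a left and a right convolution inverse of
   (x, y) |-> l (x * y) on H (x) H. *)
Fact weight_inv_monoid l : monoid_morphism (weight_inv_fun l).
Proof.
have wbil : bilinear_map (fun x y => weight_inv_fun l x * l y : R^o).
  split=> z k u v /=; first by rewrite weight_inv_linear /GRing.scale /=; ring.
  by rewrite linearP /GRing.scale /=; ring.
split=> [|x y].
  have := weight_invl l 1; rewrite !rmorph1 -tens11 tens_liftE //.
  by rewrite /= rmorph1 mulr1.
pose i := weight_inv_fun l.
have iP : linear i := weight_inv_linear l.
have iDl k u v z : i ((k *: u + v) * z) = k * i (u * z) + i (v * z).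
  by rewrite mulrDl -(scalerAl k u z) iP.
have iDr k u v z : i (z * (k *: u + v)) = k * i (z * u) + i (z * v).
  by rewrite mulrDr -(scalerAr k z u) iP.
have iZ k u : i (k *: u) = k * i u by rewrite /i /weight_inv_fun !linearZ.
pose Q a c b1 d1 b2 d2 : R^o := i (a * c) * (l b1 * l d1) * (i b2 * i d2).
pose sw (f : H -> H -> R^o) (h : H) := tens_lift f (comul h).
have lQ1 c b1 d1 b2 d2 : linear (fun a => Q a c b1 d1 b2 d2).
  by move=> k u v; rewrite /Q iDl /GRing.scale /=; ring.
have lQ2 a b1 d1 b2 d2 : linear (fun c => Q a c b1 d1 b2 d2).
  by move=> k u v; rewrite /Q iDr /GRing.scale /=; ring.
have lQ3 a c d1 b2 d2 : linear (fun b1 => Q a c b1 d1 b2 d2).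
  by move=> k u v; rewrite /Q linearP /GRing.scale /=; ring.
have lQ4 a c b1 b2 d2 : linear (fun d1 => Q a c b1 d1 b2 d2).
  by move=> k u v; rewrite /Q linearP /GRing.scale /=; ring.
have lQ5 a c b1 d1 d2 : linear (fun b2 => Q a c b1 d1 b2 d2).
  by move=> k u v; rewrite /Q iP /GRing.scale /=; ring.
have lQ6 a c b1 d1 b2 : linear (fun d2 => Q a c b1 d1 b2 d2).
  by move=> k u v; rewrite /Q iP /GRing.scale /=; ring.
pose E1 := sw (fun a b => sw (fun b1 b2 => sw (fun c d => sw (fun d1 d2 =>
   Q a c b1 d1 b2 d2) d) y) b) x.
pose E2 := sw (fun a b => sw (fun a1 a2 => sw (fun c d => sw (fun c1 c2 =>
   Q a1 c1 a2 c2 b d) c) y) a) x.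
have E12 : E1 = E2.
  rewrite /E1 /E2 /sw.
  under tens_lift_ext => a b do under tens_lift_ext => b1 b2 do
    rewrite coassoc_lift //.
  rewrite coassoc_lift // => *; apply: linear_tens_lift => *;
    exact: linear_tens_lift.
have E1E : E1 = i (x * y).
  rewrite -[x in RHS]counitr -[y in RHS]counitr.
  rewrite /E1 /sw.
  transitivity (sw (fun a b => sw (fun c d => i (a * c) * counit b * counit d : R^o) y) x).
    apply: tens_lift_ext => a b; rewrite tens_lift_exchange.
    apply: tens_lift_ext => c d.
    rewrite -(weight_invr l b) -(weight_invr l d) -mulrA tens_lift_mulr tens_lift_mull.
    apply: tens_lift_ext => b1 b2; rewrite !tens_lift_mull.
    by apply: tens_lift_ext => d1 d2; rewrite /Q -/i; ring.
  have ilin z : linear (fun u => i (u * z)).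
    by move=> k u v; apply: iDl.
  rewrite (lin_tens_lift _ _ (ilin _)); apply: tens_lift_ext => a b.
  have jlin z : linear (fun u => i (z * u)).
    by move=> k u v; apply: iDr.
  rewrite (lin_tens_lift _ _ (jlin _)); apply: tens_lift_ext => c d.
  by rewrite -(scalerAl (counit b) a) -(scalerAr (counit d)) !iZ; ring.
have E2E : E2 = i x * i y.
  rewrite -[x in RHS]counitl -[y in RHS]counitl.
  transitivity (sw (fun a b => sw (fun c d => counit a * counit c * (i b * i d) : R^o) y) x).
    apply: tens_lift_ext => a b; rewrite /sw tens_lift_exchange.
    apply: tens_lift_ext => c d.
    have -> : counit a * counit c = counit (a * c) :> R^o by rewrite rmorphM.
    rewrite -(weight_invl l) rmorphM tens_lift_mul //.
    rewrite tens_lift_mulr; apply: tens_lift_ext => a1 a2.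
    rewrite tens_lift_mulr; apply: tens_lift_ext => c1 c2.
    by rewrite /Q rmorphM.
  rewrite (lin_tens_lift _ _ iP) tens_lift_mulr; apply: tens_lift_ext => a b.
  rewrite (lin_tens_lift _ _ iP) tens_lift_mull; apply: tens_lift_ext => c d.
  by rewrite !iZ; ring.
by rewrite -[LHS]E1E E12 E2E.
Qed.

HB.instance Definition _ l :=
  GRing.isLinear.Build R H R^o _ (weight_inv_fun l) (weight_inv_linear l).
HB.instance Definition _ l :=
  GRing.isMonoidMorphism.Build H R^o (weight_inv_fun l) (weight_inv_monoid l).

Definition weight_inv l : weight := weight_inv_fun l : {lrmorphism H -> R^o}.

Fact weight_mulVl : left_inverse weight_one weight_inv weight_mul.
Proof. by move=> l; apply: weightP => h; apply: weight_invl. Qed.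
Fact weight_mulVr : right_inverse weight_one weight_inv weight_mul.
Proof. by move=> l; apply: weightP => h; apply: weight_invr. Qed.

HB.instance Definition _ := isGroup.Build weight
  weight_mulA weight_mul1l weight_mul1r weight_mulVl weight_mulVr.

Lemma weight_mulE l m h :
  (l * m)%g h = tens_lift (fun x y => l x * m y : R^o) (comul h).
Proof. by []. Qed.
Lemma weight_oneE h : (1%g : weight) h = counit h.
Proof. by []. Qed.
Lemma weight_invE l h : (l^-1)%g h = l (antipode h).
Proof. by []. Qed.

End Weights.

Section Grouplike.
Variables (R : comNzRingType) (H : hopfAlg R).

Definition is_grouplike (x : H) : Prop := comul x = x ⊗ x /\ counit x = 1.

Record grouplike := Grouplike {
  grouplike_val :> H;
  grouplike_prop : `[< is_grouplike grouplike_val >]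
}.

HB.instance Definition _ := [isSub for grouplike_val].
HB.instance Definition _ := [Choice of grouplike by <:].

Implicit Types x y : grouplike.

Lemma comul_grouplike x : comul x = (x : H) ⊗ (x : H).
Proof. by have /asboolP[] := grouplike_prop x. Qed.
Lemma counit_grouplike x : counit x = 1.
Proof. by have /asboolP[] := grouplike_prop x. Qed.

Fact antipode_grouplike_l x : antipode x * (x : H) = 1.
Proof.
have := antipodel (x : H); rewrite comul_grouplike counit_grouplike scale1r tens_liftE //.
split=> z k u v /=; first by rewrite linearP mulrDl -(scalerAl k (antipode u)).
by rewrite mulrDr -(scalerAr k (antipode z)).
Qed.

Fact antipode_grouplike_r x : (x : H) * antipode x = 1.
Proof.
have := antipoder (x : H); rewrite comul_grouplike counit_grouplike scale1r tens_liftE //.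
split=> z k u v /=; first by rewrite mulrDl -(scalerAl k u).
by rewrite linearP mulrDr -(scalerAr k z).
Qed.

Fact grouplike_one_subproof : `[< is_grouplike 1 >].
Proof. by apply/asboolP; split; rewrite rmorph1 ?tens11. Qed.

Fact grouplike_mul_subproof x y : `[< is_grouplike ((x : H) * (y : H)) >].
Proof.
apply/asboolP; split; rewrite rmorphM.
  by rewrite /= !comul_grouplike tensM.
by rewrite /= !counit_grouplike mulr1.
Qed.

Fact grouplike_inv_subproof x : `[< is_grouplike (antipode x) >].
Proof.
apply/asboolP; split.
  have e1 : comul (antipode x) * ((x : H) ⊗ (x : H)) = 1.
    by rewrite -comul_grouplike -rmorphM antipode_grouplike_l rmorph1.
  have e2 : ((x : H) ⊗ (x : H)) * (antipode x ⊗ antipode x) = 1 :> H ⊗ H.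
    by rewrite tensM !antipode_grouplike_r tens11.
  by rewrite -[LHS]mulr1 -e2 mulrA e1 mul1r.
have : counit (antipode x * (x : H)) = 1 by rewrite antipode_grouplike_l rmorph1.
by rewrite rmorphM /= counit_grouplike mulr1.
Qed.

Definition grouplike_one := Grouplike grouplike_one_subproof.
Definition grouplike_mul x y := Grouplike (grouplike_mul_subproof x y).
Definition grouplike_inv x := Grouplike (grouplike_inv_subproof x).

Fact grouplike_mulA : associative grouplike_mul.
Proof. by move=> x y z; apply: val_inj; apply: mulrA. Qed.
Fact grouplike_mul1l : left_id grouplike_one grouplike_mul.
Proof. by move=> x; apply: val_inj; apply: mul1r. Qed.
Fact grouplike_mul1r : right_id grouplike_one grouplike_mul.
Proof. by move=> x; apply: val_inj; apply: mulr1. Qed.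
Fact grouplike_mulVl : left_inverse grouplike_one grouplike_inv grouplike_mul.
Proof. by move=> x; apply: val_inj; apply: antipode_grouplike_l. Qed.
Fact grouplike_mulVr : right_inverse grouplike_one grouplike_inv grouplike_mul.
Proof. by move=> x; apply: val_inj; apply: antipode_grouplike_r. Qed.

HB.instance Definition _ := isGroup.Build grouplike grouplike_mulA
  grouplike_mul1l grouplike_mul1r grouplike_mulVl grouplike_mulVr.

End Grouplike.

(* A finite subgroup of a possibly infinite group, which is itself a
   finGroupType through its type of elements. *)
Record finSubgroup (G : groupType) := FinSubgroup {
  fsub_set : {fset G};
  fsub_closed : group_closed (fun x => x \in fsub_set)
}.

Definition fsub_elt (G : groupType) (P : finSubgroup G) : predArgType :=
  fset_sub_type (fsub_set P).
Coercion fsub_elt : finSubgroup >-> predArgType.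

Section FinSubgroup.
Variables (G : groupType) (P : finSubgroup G).
HB.instance Definition _ := SubChoice.on (fsub_elt P).
HB.instance Definition _ := Finite.on (fsub_elt P).
HB.instance Definition _ :=
  SubChoice_isSubGroup.Build G (fun x => x \in fsub_set P) (fsub_elt P)
    (fsub_closed P).
End FinSubgroup.

Section PseudoPrimitive.
Variables (R : comNzRingType) (H : hopfAlg R) (Pi : finSubgroup (weight H)).

Definition pseudo_primitive (h : H) (g g' : grouplike H) : Prop :=
  comul h = (g : H) ⊗ h + h ⊗ (g' : H) /\
  forall gamma : Pi, (val gamma : weight H) (grouplike_val (g^-1 * g')%g) = 1 :> R.

Definition sum_weights (L : {set Pi}) (x : H) : R :=
  \sum_(gamma in L) (val gamma : weight H) x.

End PseudoPrimitive.

Local Open Scope group_scope.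

Definition abelianization (gT : finGroupType) :=
  ([set: gT] / [~: [set: gT], [set: gT]])%G.

(* L contains exactly one lift of each element of Theta, and nothing else. *)
Definition lifts (gT : finGroupType) (N : {set gT})
    (Theta : {set coset_of N}) (L : {set gT}) : Prop :=
  {in L &, injective (coset N)} /\ coset N @: L = Theta.

(* Main.v *)
Require Import Defs.
From mathcomp Require Import all_boot all_algebra all_fingroup all_solvable.
Set Implicit Arguments.
Unset Strict Implicit.
Unset Printing Implicit Defensive.
Local Open Scope ring_scope.

(* On Pi the map gamma |-> gamma (g_i) is a character and
   gamma |-> gamma (h_i) / gamma (g_i) is additive, so both factor through the
   abelianization Phi.  The p-part has trivial characters (x ^ (p ^ k) = 1 forces
   x = 1 in a domain of characteristic p), and the p'-part has no nonzero
   additive maps to R, so the summand at a product xy, with x over Phi' and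
   y over Phi_p, is x (g_1 .. g_n) * y (h_1 .. h_n). *)

Import GRing.Theory.

(** The elements where [f] agrees with its value at 1 form a subgroup, and it contains every
    commutator because [op] lets the factors be reordered until they cancel in the group. A general
    commutative law covers both multiplicative characters and additive maps. *)
Lemma com_law_der1 (T : eqType) (op : SemiGroup.com_law T) (gT : finGroupType)
    (f : gT -> T) : {morph f : x y / (x * y)%g >-> op x y} ->
  {in [~: [set: gT], [set: gT]]%g, forall x, f x = f 1%g}.
Proof.
move=> fM; pose K := [set x | f x == f 1%g].
have K_group : group_set K.
  apply/group_setP; split=> [|x y]; rewrite !inE // => /eqP fx /eqP fy.
  by rewrite fM fx fy -fM mulg1.
suff sNK : [~: [set: gT], [set: gT]]%g \subset Group K_group.
  by move=> x /(subsetP sNK); rewrite inE => /eqP.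
rewrite gen_subG; apply/subsetP=> _ /imset2P[x y _ _ ->]; rewrite inE.
rewrite /commg /conjg !fM (SemiGroup.Theory.mulmCA op (f y^-1%g)).
by rewrite -!fM mulVg mulg1 mulVg.
Qed.

Lemma lifts_card (gT : finGroupType) (N : {set gT}) (Theta : {set coset_of N})
    (L : {set gT}) : lifts Theta L -> #|L| = #|Theta|.
Proof. by case=> injL <-; rewrite card_in_imset. Qed.

Lemma lifts_coset (gT : finGroupType) (N : {set gT}) (Theta : {set coset_of N})
    (L : {set gT}) x : lifts Theta L -> x \in L -> coset N x \in Theta.
Proof. by case=> _ <-; apply: imset_f. Qed.

(** Each element of the group is uniquely a product [k * x * y]: the factorization is injective
    since [A] and [B] meet trivially, hence bijective by counting. *)
Lemma sum_lifts (R : nzRingType) (gT : finGroupType) (N : {group gT})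
    (A B : {group coset_of N}) (LA LB : {set gT}) (F : gT -> R) :
    (N <| [set: gT])%g -> (#|A| * #|B|)%N = #|([set: gT] / N)%g| ->
    (A :&: B = 1)%g -> lifts A LA -> lifts B LB ->
  \sum_x F x = \sum_(k in N) \sum_(x in LA) \sum_(y in LB) F (k * x * y)%g.
Proof.
move=> nN cardAB tiAB liftA liftB.
pose S := setX (setX N LA) LB.
pose f (u : gT * gT * gT) := (u.1.1 * u.1.2 * u.2)%g.
have inN x : x \in 'N(N)%g by rewrite (subsetP (normal_norm nN)) ?inE.
have injf : {in S &, injective f}.
  move=> [[k x] y] [[k' x'] y']; rewrite !in_setX /f /=.
  move=> /andP[/andP[kN xA] yB] /andP[/andP[k'N x'A] y'B] Exy.
  have /= := congr1 (coset N) Exy.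
  rewrite !morphM ?inN ?groupM ?inN //= (coset_id kN) (coset_id k'N) !mul1g => Ec.
  (* The left side lies in [A] and the right side in [B], so both are trivial. *)
  have cA : (coset N x'^-1 * coset N x = coset N y' * coset N y^-1)%g.
    by rewrite !morphV ?inN //= (canRL (mulgK _) Ec) -mulgA mulKg.
  have cV : (coset N x'^-1 * coset N x \in A :&: B)%g.
    rewrite inE {2}cA !morphV ?inN // !groupM ?groupV //;
      by [apply: lifts_coset liftA _ | apply: lifts_coset liftB _].
  have Ex : x = x'.
    apply: liftA.1 => //; apply/eqP; rewrite eq_sym eq_mulVg1 -morphV ?inN //.
    by move: cV; rewrite tiAB inE.
  have Ey : y = y' by apply: liftB.1 => //; move: Ec; rewrite Ex => /mulgI.
  by move: Exy; rewrite Ex Ey => /mulIg/mulIg ->.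
have fS : f @: S = [set: gT].
  (* By Lagrange, [S] has as many elements as the whole group. *)
  apply/eqP; rewrite eqEcard subsetT card_in_imset // !cardsX.
  rewrite (lifts_card liftA) (lifts_card liftB) -mulnA cardAB.
  by rewrite (card_quotient (normal_norm nN)) (Lagrange (normal_sub nN)) leqnn.
transitivity (\sum_(x in [set: gT]) F x).
  by apply: eq_bigl => x; rewrite inE.
rewrite -fS big_imset //= !pair_big /=.
by apply: eq_bigl => -[[k x] y]; rewrite !in_setX.
Qed.

(** As [m] is a power of the characteristic, [x ^+ m - 1] equals [(x - 1) ^+ m], and a domain has no
    nonzero nilpotents. *)
Lemma pnat_expr_eq1 (R : idomainType) (p m : nat) (x : R) :
  p \in [pchar R] -> p.-nat m -> x ^+ m = 1 -> x = 1.
Proof.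
move=> pR pm xm; have Rm : [pchar R].-nat m by rewrite (eq_pnat _ (pcharf_eq pR)).
have : (x - 1) ^+ m = 0.
  apply: (addIr 1); rewrite -[X in _ + X](expr1n _ m) -exprDn_pchar //.
  by rewrite subrK xm add0r.
by move/eqP; rewrite expf_eq0 subr_eq0 => /andP[_ /eqP].
Qed.

Section WeightValues.
Variables (R : comNzRingType) (H : hopfAlg R).
Implicit Types l m : weight H.

Lemma bilinear_weights l m : bilinear_map (fun x y => l x * m y : R^o).
Proof.
split=> z k x y; rewrite linearP /GRing.scale /=.
  by rewrite mulrDl mulrA.
by rewrite mulrDr mulrCA.
Qed.

Lemma weight_mul_grouplike l m (x : grouplike H) :
  (l * m)%g (x : H) = l (x : H) * m (x : H) :> R.
Proof.
by rewrite weight_mulE comul_grouplike tens_liftE //; apply: bilinear_weights.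
Qed.

Lemma weight_grouplikeV l (x : grouplike H) :
  l (x : H) * l (grouplike_val x^-1%g) = 1 :> R.
Proof. by rewrite -rmorphM antipode_grouplike_r rmorph1. Qed.

Lemma weight_mul_skew l m (x : H) (g g' : grouplike H) :
    comul x = (g : H) ⊗ x + x ⊗ (g' : H) ->
  (l * m)%g x = l (g : H) * m x + l x * m (g' : H) :> R.
Proof.
move=> xE; have lm := bilinear_weights l m.
by rewrite weight_mulE xE tens_liftD // !tens_liftE.
Qed.

End WeightValues.

Section PseudoPrimitiveWeights.
Variables (R : comNzRingType) (H : hopfAlg R) (Pi : finSubgroup (weight H)).
Implicit Types x y : Pi.

Lemma weight_valM x y : val (x * y)%g = (val x * val y)%g :> weight H.
Proof. by []. Qed.

(** The factor at [g^-1] plays the role of division by the value at [g]. Weights in [Pi] agree on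
    [g] and [g'], so [(x * y) h] is [x g * y h + x h * y g]; dividing by [x g * y g] leaves the sum
    of the two quotients. *)
Lemma pseudo_primitive_additive (h : H) (g g' : grouplike H) :
    pseudo_primitive Pi h g g' ->
  {morph (fun x : Pi => (val x : weight H) h *
                        (val x : weight H) (grouplike_val g^-1%g) : R)
    : x y / (x * y)%g >-> x + y}.
Proof.
move=> [hE gg'] x y; have gV := weight_grouplikeV _ g.
have Eg : (val y : weight H) (g' : H) = (val y : weight H) (g : H) :> R.
  have := gg' y; rewrite [X in (val y : weight H) X]/= rmorphM => E.
  by rewrite -[LHS]mul1r -(gV (val y)) -mulrA E mulr1.
rewrite weight_valM (weight_mul_skew _ _ hE) weight_mul_grouplike Eg.
rewrite mulrDl mulrACA gV mul1r addrC; congr (_ + _).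
by rewrite mulrACA gV mulr1.
Qed.

End PseudoPrimitiveWeights.

(** This turns the orders of [Phi_p] and [Phi'] into torsion relations on the values of maps that
    are trivial on [N]. *)
Lemma lift_expg_card (gT : finGroupType) (N : {group gT})
    (A : {group coset_of N}) (L : {set gT}) x :
  (N <| [set: gT])%g -> lifts A L -> x \in L -> (x ^+ #|A|)%g \in N.
Proof.
move=> nN liftA xL; have nx : x \in 'N(N)%g.
  by rewrite (subsetP (normal_norm nN)) ?inE.
apply: coset_idr; first exact: groupX.
by rewrite morphX // expg_cardG // (lifts_coset liftA).
Qed.

Theorem theorem7p5 (R : idomainType) (p : nat) (charR : p \in [pchar R])
    (H : hopfAlg R) (Pi : finSubgroup (weight H))
    (n : nat) (n_gt0 : (0 < n)%N)
    (h : 'I_n -> H) (g g' : 'I_n -> grouplike H)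
    (h_pp : forall i, pseudo_primitive Pi (h i) (g i) (g' i))
    (Phi_p Phi' : {group coset_of [~: [set: Pi], [set: Pi]]%g})
    (Phi_p_syl : (p.-Sylow(abelianization Pi) Phi_p)%g)
    (Phi'_sub : Phi' \subset abelianization Pi)
    (Phi'_card : #|Phi'| = (#|abelianization Pi| %/ #|Phi_p|)%N)
    (Lp L' : {set Pi}) (Lp_lifts : lifts Phi_p Lp) (L'_lifts : lifts Phi' L') :
  sum_weights [set: Pi] (\prod_(i < n) h i) =
  #|[~: [set: Pi], [set: Pi]]%g|%:R
    * sum_weights L' (\prod_(i < n) (g i : H))
    * sum_weights Lp (\prod_(i < n) h i).
Proof.
have pr_p := pcharf_prime charR.
pose N := [~: [set: Pi], [set: Pi]]%G; have nN : (N <| [set: Pi])%g := der_normal 1 _.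
pose gg := (\prod_(i < n) g i)%g : grouplike H.
have ggE : \prod_(i < n) (g i : H) = (gg : H) :> H.
  by rewrite /gg; symmetry; apply: (big_morph (@grouplike_val _ H)).
pose c (x : Pi) : R := (val x : weight H) (gg : H).
have cM : {morph c : x y / (x * y)%g >-> x * y}
  by move=> x y; apply: weight_mul_grouplike.
have c1 : c 1%g = 1 by apply: counit_grouplike.
have cX x k : c (x ^+ k)%g = c x ^+ k.
  by elim: k => [|k IHk]; rewrite ?c1 // expgS exprS cM IHk.
pose a i (x : Pi) : R :=
  (val x : weight H) (h i) * (val x : weight H) (grouplike_val (g i)^-1%g).
have aD i : {morph a i : x y / (x * y)%g >-> x + y}
  by apply: pseudo_primitive_additive.
have a1 i : a i 1%g = 0 by apply: (addrI (a i 1%g)); rewrite -aD mulg1 addr0.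
have aX i x k : a i (x ^+ k)%g = a i x *+ k.
  by elim: k => [|k IHk]; rewrite ?a1 // expgS mulrS aD IHk.
(* Each [x (h i)] is [x (g i) * a i x]; the first factors multiply to [c x]. *)
have FE x : (val x : weight H) (\prod_(i < n) h i) = c x * \prod_(i < n) a i x :> R.
  rewrite /c -ggE !rmorph_prod -big_split /=; apply: eq_bigr => i _.
  by rewrite mulrCA weight_grouplikeV mulr1.
have cN : {in N, forall x, c x = 1} by move=> x xN; rewrite (com_law_der1 cM) // c1.
have aN i : {in N, forall x, a i x = 0}.
  by move=> x xN; rewrite (com_law_der1 (aD i)) // a1.
have cLp y : y \in Lp -> c y = 1.
  move=> yL; apply: (pnat_expr_eq1 charR (pHall_pgroup Phi_p_syl)).
  by rewrite -cX cN // (lift_expg_card nN Lp_lifts).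
have p'Phi' : p^'.-nat #|Phi'|.
  rewrite Phi'_card (card_Hall Phi_p_syl) -{1}(partnC p (cardG_gt0 _)).
  by rewrite mulKn ?part_pnat.
have aL' i x : x \in L' -> a i x = 0.
  move=> xL; have /eqP : a i x *+ #|Phi'| = 0.
    by rewrite -aX aN // (lift_expg_card nN L'_lifts).
  (* In a domain either [a i x] or the image of [#|Phi'|] vanishes; the latter would make [p] divide
     a number prime to [p]. *)
  rewrite -mulr_natr mulf_eq0 => /orP[/eqP-> //|].
  rewrite -(dvdn_pcharf charR) => /pnat_dvd/(_ p'Phi').
  by rewrite pnatE // !inE eqxx.
have cardPhi : (#|Phi'| * #|Phi_p|)%N = #|([set: Pi] / N)%g|.
  by rewrite Phi'_card divnK // cardSg // (pHall_sub Phi_p_syl).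
have ti : (Phi' :&: Phi_p = 1)%g.
  rewrite setIC; apply: coprime_TIg; apply: pnat_coprime p'Phi'.
  exact: pHall_pgroup Phi_p_syl.
rewrite /sum_weights ggE.
rewrite (eq_bigl xpredT) => [|x]; last by rewrite inE.
rewrite (sum_lifts _ nN cardPhi ti L'_lifts Lp_lifts).
(* The factor [#|N|] becomes a constant sum over [N], so the two sides are compared term by term. *)
rewrite -mulrA mulr_natl -sumr_const; apply: eq_bigr => k kN.
rewrite mulr_suml; apply: eq_bigr => x xL.
rewrite mulr_sumr; apply: eq_bigr => y yL.
(* At [k * x * y], the character [c] sees only [x] and each [a i] sees only [y]. *)
rewrite !FE !cM (cN k kN) (cLp y yL) !(mul1r, mulr1); congr (_ * _).
by apply: eq_bigr => i _; rewrite !aD (aN i k kN) (aL' i x xL) !add0r.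
Qed.
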